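(* (Variation of Parameters Formula) Let $A,B,F,G$ be real $n\times n$ matrices with $F+G$ and $F-G$ invertible, and let $\gamma:\mathbb R\to\mathbb R^n$ be continuous. Let $X$ and $Y$ be fundamental matrices of the homogeneous problems associated, respectively, with $$(\mathrm{I})\quad Fu'(t)+Gu'(-t)+Au(t)+Bu(-t)=\gamma(t),\ t\in\mathbb R,$$ $$(\mathrm{II})\quad Fu'(t)-Gu'(-t)+Au(t)-Bu(-t)=\gamma(t),\ t\in\mathbb R,$$ and let $$\mathcal X=\left(\begin{array}{c|c}X_e&Y_o\\\hline X_o&Y_e\end{array}\right).$$ Then the solutions of problem $(\mathrm{I})$, in a neighborhood of zero, are of the form $$u(t)=X(t)c+\bigl(X(t)\,|\,Y(t)\bigr)\int_0^t\mathcal X(s)^{-1}\begin{pmatrix}(F-G)^{-1}\gamma_o(s)\\(F+G)^{-1}\gamma_e(s)\end{pmatrix}ds,$$ where $c\in\mathbb R^n$.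
   Context: For a function $f$ on $\mathbb R$ (vector- or matrix-valued), $f_e(t)=\tfrac12(f(t)+f(-t))$ and $f_o(t)=\tfrac12(f(t)-f(-t))$ are its even and odd parts. $(X(t)\,|\,Y(t))$ is the $n\times 2n$ block matrix. $u'(-t)$ is the derivative of $u$ evaluated at $-t$. A fundamental matrix of $F u'(t)+G u'(-t)+Au(t)+Bu(-t)=0$, $t\in\mathbb R$, is a continuous $X:\mathbb R\to M_n(\mathbb R)$ that is differentiable, satisfies $FX'(t)+GX'(-t)+AX(t)+BX(-t)=0$ for all $t\in\mathbb R$, has $X(0)$ invertible, and whose columns form a basis of the space of solutions of the system; for problem (II) replace $G,B$ by $-G,-B$. *)

(* Defs.v *)
From HB Require Import structures.
From mathcomp Require Import all_boot all_order all_algebra.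
From mathcomp Require Import all_classical all_reals all_analysis.

Set Implicit Arguments.
Unset Strict Implicit.
Unset Printing Implicit Defensive.

Import Order.TTheory GRing.Theory Num.Theory.
Import numFieldNormedType.Exports.

Local Open Scope classical_set_scope.
Local Open Scope ring_scope.

Section EvenOdd.
Variables (R : realType) (V : lmodType R).

Definition even_part (f : R -> V) (t : R) : V := 2^-1 *: (f t + f (- t)).
Definition odd_part (f : R -> V) (t : R) : V := 2^-1 *: (f t - f (- t)).

End EvenOdd.

Section Integral.
Variable R : realType.

Definition oriented_integral (a b : R) (f : R -> R) : R :=
  if a <= b then \int[@lebesgue_measure R]_(s in `[a, b]) f s
  else - \int[@lebesgue_measure R]_(s in `[b, a]) f s.

Definition mx_integral m n (a b : R) (f : R -> 'M[R]_(m, n)) : 'M[R]_(m, n) :=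
  \matrix_(i, j) oriented_integral a b (fun s => f s i j).

End Integral.

(* [S] is meant to be a linear subspace of [V]. *)
Definition basis_of_subspace (R : realType) (V : lmodType R) n
    (S : set V) (b : 'I_n -> V) : Prop :=
  [/\ forall i, S (b i),
      forall c : 'I_n -> R, \sum_i c i *: b i = 0 -> forall i, c i = 0
    & forall v, S v -> exists c : 'I_n -> R, v = \sum_i c i *: b i].

Section ReflectionSystem.
Variables (R : realType) (n : nat).
Implicit Types F G A B : 'M[R]_n.

(* [u] satisfies F u'(t) + G u'(-t) + A u(t) + B u(-t) = g(t) for t in [D].
   [D] should be symmetric about 0 and open, so that u'(t) and u'(-t) both
   exist and depend only on the values of [u] on [D]. *)
Definition solution_on (D : set R) F G A B m (g u : R -> 'M[R]_(n, m)) : Prop :=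
  forall t, D t -> derivable u t 1 /\
    F *m derive1 u t + G *m derive1 u (- t) + A *m u t + B *m u (- t) = g t.

Definition homogeneous_solutions F G A B : set (R -> 'cV[R]_n) :=
  [set u | solution_on setT F G A B (fun=> 0) u].

Definition fundamental_matrix F G A B (X : R -> 'M[R]_n) : Prop :=
  [/\ continuous X,
      solution_on setT F G A B (fun=> 0) X,
      X 0 \in unitmx
    & basis_of_subspace (homogeneous_solutions F G A B)
        (fun (j : 'I_n) (t : R) => col j (X t))].

Definition calX (X Y : R -> 'M[R]_n) (t : R) : 'M[R]_(n + n) :=
  block_mx (even_part X t) (odd_part Y t) (odd_part X t) (even_part Y t).

Definition variation_of_parameters F G (gamma : R -> 'cV[R]_n)
    (X Y : R -> 'M[R]_n) (c : 'cV[R]_n) (t : R) : 'cV[R]_n :=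
  X t *m c +
  row_mx (X t) (Y t) *m
    mx_integral 0 t (fun s => invmx (calX X Y s) *m
      col_mx (invmx (F - G) *m odd_part gamma s)
             (invmx (F + G) *m even_part gamma s)).

End ReflectionSystem.

(* Main.v *)
Require Import Defs.
From HB Require Import structures.
From mathcomp Require Import all_boot all_order all_algebra.
From mathcomp Require Import all_classical all_reals all_analysis.
From mathcomp Require Import ring lra.

Set Implicit Arguments.
Unset Strict Implicit.
Unset Printing Implicit Defensive.

Import Order.TTheory GRing.Theory Num.Theory.
Import numFieldNormedType.Exports.

Local Open Scope classical_set_scope.
Local Open Scope ring_scope.

(* Splitting a solution u of (I) into even and odd parts turns the equation with
   reflection into the ordinary linear system z' = M z + h for z = (u_e; u_o),
   with M = generator F G A B and h = forcing F G gamma.  The matrix calX built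
   from X and Y satisfies calX' = M calX and calX(0) = diag(X(0), Y(0)), so by
   uniqueness for linear systems it is invertible at every point, not only near
   zero.  Classical variation of constants then gives
   z = calX ((c; 0) + int_0^t calX^-1 h): the initial value has zero lower block
   because an odd function vanishes at 0.  Conversely, since diag(1, -1) M =
   - M diag(1, -1) and h is (odd; even), uniqueness forces the two blocks of such
   a z to be even and odd, so that their sum solves (I). *)

(** * Derivatives and continuity of matrix-valued functions *)

Section MatrixCalculus.
Variable R : realType.
Implicit Types t : R.

(** Reduction to entries, through which the scalar differentiation rules carry over to products,
    blocks and reflections. *)
Lemma is_derive_mxP m n (Z : R -> 'M[R]_(m, n)) t D :
  is_derive t 1 Z D <-> forall i j, is_derive t 1 (fun s => Z s i j) (D i j).
Proof.
split=> [[dZ <-] i j|dZ].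
  apply: DeriveDef; first by move/derivable_mxP : dZ.
  by rewrite derive_mx // mxE.
have dvZ : derivable Z t 1 by apply/derivable_mxP => i j; have [] := dZ i j.
apply: DeriveDef => //; rewrite derive_mx //.
by apply/matrixP => i j; rewrite mxE; have [_ <-] := dZ i j.
Qed.

Lemma is_derive_mulmx m n p (P : R -> 'M[R]_(m, n)) (Q : R -> 'M[R]_(n, p))
    t dP dQ :
  is_derive t 1 P dP -> is_derive t 1 Q dQ ->
  is_derive t 1 (fun s => P s *m Q s) (dP *m Q t + P t *m dQ).
Proof.
move=> /is_derive_mxP hP /is_derive_mxP hQ; apply/is_derive_mxP => i j.
have -> : (fun s => (P s *m Q s) i j) =
    \sum_(k < n) (fun s => P s i k) * (fun s => Q s k j).
  by rewrite fct_sumE; apply/funext => s; rewrite mxE.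
apply: (is_derive_eq (is_derive_sum (fun k => is_deriveM (hP i k) (hQ k j)))).
rewrite !mxE -big_split /=; apply: eq_bigr => k _.
by rewrite addrC; congr (_ + _); exact: mulrC.
Qed.

Lemma is_derive_mulmxr m n p (P : R -> 'M[R]_(m, n)) (Q : 'M[R]_(n, p)) t dP :
  is_derive t 1 P dP -> is_derive t 1 (fun s => P s *m Q) (dP *m Q).
Proof.
move=> hP; apply: (is_derive_eq (is_derive_mulmx hP (is_derive_cst Q t 1))).
by rewrite mulmx0 addr0.
Qed.

Lemma is_derive_mulmxl m n p (P : 'M[R]_(m, n)) (Q : R -> 'M[R]_(n, p)) t dQ :
  is_derive t 1 Q dQ -> is_derive t 1 (fun s => P *m Q s) (P *m dQ).
Proof.
move=> hQ; apply: (is_derive_eq (is_derive_mulmx (is_derive_cst P t 1) hQ)).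
by rewrite mul0mx add0r.
Qed.

Lemma is_derive_col_mx m1 m2 n (P : R -> 'M[R]_(m1, n)) (Q : R -> 'M[R]_(m2, n))
    t dP dQ :
  is_derive t 1 P dP -> is_derive t 1 Q dQ ->
  is_derive t 1 (fun s => col_mx (P s) (Q s)) (col_mx dP dQ).
Proof.
move=> /is_derive_mxP hP /is_derive_mxP hQ; apply/is_derive_mxP => i j.
case: (splitP i) => k ik.
  have -> : i = lshift m2 k by exact: val_inj.
  by rewrite col_mxEu; under eq_fun do rewrite col_mxEu.
have -> : i = rshift m1 k by exact: val_inj.
by rewrite col_mxEd; under eq_fun do rewrite col_mxEd.
Qed.

Lemma is_derive_row_mx m n1 n2 (P : R -> 'M[R]_(m, n1)) (Q : R -> 'M[R]_(m, n2))
    t dP dQ :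
  is_derive t 1 P dP -> is_derive t 1 Q dQ ->
  is_derive t 1 (fun s => row_mx (P s) (Q s)) (row_mx dP dQ).
Proof.
move=> /is_derive_mxP hP /is_derive_mxP hQ; apply/is_derive_mxP => i j.
case: (splitP j) => k jk.
  have -> : j = lshift n2 k by exact: val_inj.
  by rewrite row_mxEl; under eq_fun do rewrite row_mxEl.
have -> : j = rshift n1 k by exact: val_inj.
by rewrite row_mxEr; under eq_fun do rewrite row_mxEr.
Qed.

Lemma is_derive_mx_comp_opp m n (Z : R -> 'M[R]_(m, n)) t D :
  is_derive (- t) 1 Z D -> is_derive t 1 (fun s => Z (- s)) (- D).
Proof.
move=> /is_derive_mxP hZ; apply/is_derive_mxP => i j; rewrite mxE -mulrN1.
exact: (is_derive1_comp (hZ i j)).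
Qed.

Lemma is_derive_even_part m n (Z : R -> 'M[R]_(m, n)) t D D' :
  is_derive t 1 Z D -> is_derive (- t) 1 Z D' ->
  is_derive t 1 (even_part Z) (2^-1 *: (D - D')).
Proof.
move=> dZ /is_derive_mx_comp_opp dZ'.
exact: (is_deriveZ _ (is_deriveD dZ dZ')).
Qed.

Lemma is_derive_odd_part m n (Z : R -> 'M[R]_(m, n)) t D D' :
  is_derive t 1 Z D -> is_derive (- t) 1 Z D' ->
  is_derive t 1 (odd_part Z) (2^-1 *: (D + D')).
Proof.
move=> dZ /is_derive_mx_comp_opp dZ'.
apply: (is_derive_eq (is_deriveZ _ (is_deriveB dZ dZ'))).
by rewrite opprK.
Qed.

Lemma is_derive_mx_continuous m n (Z : R -> 'M[R]_(m, n)) t D :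
  is_derive t 1 Z D -> forall i j, {for t, continuous (fun s => Z s i j)}.
Proof.
move=> /is_derive_mxP dZ i j.
by apply/differentiable_continuous/derivable1_diffP; have [] := dZ i j.
Qed.

(** The Leibniz expansion is a finite sum of products of entries. *)
Lemma continuous_det n (Z : R -> 'M[R]_n) :
  (forall i j, continuous (fun s => Z s i j)) -> continuous (fun s => \det (Z s)).
Proof.
move=> cZ; apply: continuous_big => [|s _]; first exact: add_continuous.
move=> t; apply: cvgMr.
exact: (@continuous_big _ _ _ _ _ (@mul_continuous R)).
Qed.

Lemma continuous_invmx n (Z : R -> 'M[R]_n) :
  (forall i j, continuous (fun s => Z s i j)) -> (forall s, Z s \in unitmx) ->
  forall i j, continuous (fun s => invmx (Z s) i j).
Proof.
move=> cZ uZ i j.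
(* Cramer's formula. Invertibility at every [s] selects the adjugate branch of [invmx], which
   otherwise returns its argument. *)
have -> : (fun s => invmx (Z s) i j) =
    (fun s => (\det (Z s))^-1 * cofactor (Z s) j i).
  by apply/funext => s; rewrite /invmx uZ !mxE.
move=> t; apply: cvgM.
  apply: cvgV; last exact: continuous_det.
  by have := uZ t; rewrite unitmxE unitfE.
apply: cvgMr; apply: continuous_det => k l.
by under eq_fun do rewrite !mxE; exact: cZ.
Qed.

Lemma continuous_mulmx m n p (P : R -> 'M[R]_(m, n)) (Q : R -> 'M[R]_(n, p)) :
  (forall i j, continuous (fun s => P s i j)) ->
  (forall i j, continuous (fun s => Q s i j)) ->
  forall i j, continuous (fun s => (P s *m Q s) i j).
Proof.
move=> cP cQ i j; under eq_fun do rewrite mxE.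
apply: continuous_big => [|k _]; first exact: add_continuous.
by move=> t; apply: cvgM; [exact: cP|exact: cQ].
Qed.

End MatrixCalculus.

(** * Uniqueness for linear differential systems *)

Section LinearODE.
Variable R : realType.
Implicit Types a b t : R.

(** Integrating factor: the sign of the derivative is that of [df + c * f x], which a bound on [df]
    by a multiple of [f] controls. *)
Lemma is_derive_expweight (f : R -> R) (df c x : R) : is_derive x 1 f df ->
  is_derive x 1 (fun y => f y * expR (c * y)) ((df + c * f x) * expR (c * x)).
Proof.
move=> hf.
have hc : is_derive x 1 (fun y : R => c * y) c.
  by apply: (is_derive_eq (is_deriveZ c (is_derive_id x 1))); rewrite [LHS]mulr1.
have he := is_derive1_comp (is_derive_expR (c * x)) hc.
apply: (is_derive_eq (is_deriveM hf he)).
transitivity (f x * (expR (c * x) * c) + expR (c * x) * df); [by []|ring].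
Qed.

(* Multiplying by [expR (- C * x)] (resp. [expR (C * x)]) makes [f]
   nonincreasing (resp. nondecreasing), which settles the points to the right
   (resp. left) of [t0]. *)
Lemma gronwall_eq0 (f df : R -> R) a b t0 C :
  (forall x, x \in `]a, b[ -> is_derive x 1 f (df x)) ->
  (forall x, x \in `]a, b[ -> 0 <= f x) ->
  (forall x, x \in `]a, b[ -> `|df x| <= C * f x) ->
  t0 \in `]a, b[ -> f t0 = 0 ->
  forall t, t \in `]a, b[ -> f t = 0.
Proof.
move=> hf f0 hdf t0ab ft0 t tab; apply/eqP; rewrite eq_le f0 // andbT.
have dg c x : x \in `]a, b[ -> derivable (fun y => f y * expR (c * y)) x 1.
  by move=> xab; have [] := is_derive_expweight c (hf x xab).
have cg c : {in `]a, b[%classic, continuous (fun y => f y * expR (c * y))}.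
  move=> x; rewrite inE /= => xab.
  exact/differentiable_continuous/derivable1_diffP/dg.
have dgE c x : x \in `]a, b[ -> (fun y => f y * expR (c * y))^`()%classic x =
    (df x + c * f x) * expR (c * x).
  by move=> xab; rewrite derive1E; have [_] := is_derive_expweight c (hf x xab).
have [tt0|t0t] := leP t t0.
  have : f t * expR (C * t) <= f t0 * expR (C * t0).
    apply: (@ger0_derive1_le_oo _ (fun y => f y * expR (C * y)) a b) => //.
      by move=> x; exact: dg.
    move=> x xab; rewrite dgE // mulr_ge0 ?expR_ge0 //.
    by have := hdf x xab; rewrite ler_norml -lerBlDr sub0r => /andP[].
  by rewrite ft0 mul0r pmulr_lle0 // expR_gt0.
have : f t * expR (- C * t) <= f t0 * expR (- C * t0).
  apply: (@ler0_derive1_le_oo _ (fun y => f y * expR (- C * y)) a b) => //.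
  - by move=> x; exact: dg.
  - move=> x xab; rewrite dgE // mulr_le0_ge0 ?expR_ge0 //.
    by have := hdf x xab; rewrite ler_norml mulNr subr_le0 => /andP[].
  - exact: ltW.
by rewrite ft0 mul0r pmulr_lle0 // expR_gt0.
Qed.

(** Gronwall's argument is applied to the squared Euclidean norm of [z], whose derivative is a
    quadratic form in [z]. *)
Lemma linear_ode_eq0 n (M : 'M[R]_n) (z : R -> 'cV[R]_n) a b t0 :
  (forall t, t \in `]a, b[ -> is_derive t 1 z (M *m z t)) ->
  t0 \in `]a, b[ -> z t0 = 0 -> forall t, t \in `]a, b[ -> z t = 0.
Proof.
move=> hz t0ab zt0.
pose f t := \sum_(i < n) z t i 0 * z t i 0.
pose df t := \sum_(i < n) (z t i 0 * (M *m z t) i 0 + z t i 0 * (M *m z t) i 0).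
have le_f t k : z t k 0 * z t k 0 <= f t.
  rewrite /f (bigD1 k) //= lerDl sumr_ge0 // => i _.
  by rewrite -expr2 sqr_ge0.
have f_eq0 t : f t = 0 -> z t = 0.
  move=> ft; apply/matrixP => i j; rewrite ord1 mxE.
  by apply/eqP; have := le_f t i; rewrite ft -expr2 -sqrf_eq0 eq_le sqr_ge0 andbT.
move=> t tab; apply: f_eq0.
(* Each term [2 * z_i * M_ik * z_k] of [df] is at most [2 * |M_ik| * f] in absolute value, since
   [z_i^2] and [z_k^2] are both at most [f]. *)
pose C := \sum_(i < n) \sum_(k < n) (2 * `|M i k|).
apply: (@gronwall_eq0 f df a b t0 C) => // [x xab|x _|x _|].
- have -> : f = \sum_(i < n) (fun s => z s i 0) * (fun s => z s i 0).
    by rewrite fct_sumE; apply/funext.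
  have /is_derive_mxP hzx := hz x xab.
  exact: (is_derive_sum (fun i => is_deriveM (hzx i 0) (hzx i 0))).
- by apply: sumr_ge0 => i _; rewrite -expr2 sqr_ge0.
- rewrite /df (le_trans (ler_norm_sum _ _ _)) // /C mulr_suml.
  apply: ler_sum => i _; rewrite -mulr2n normrMn normrM mulr_suml mxE.
  have -> : \sum_(k < n) 2 * `|M i k| * f x =
      (\sum_(k < n) `|M i k| * f x) *+ 2.
    by rewrite -[RHS]mulr_natl mulr_sumr; apply: eq_bigr => k _; rewrite mulrA.
  rewrite lerMn2r /= (le_trans (ler_wpM2l _ (ler_norm_sum _ _ _))) //.
  rewrite mulr_sumr; apply: ler_sum => k _.
  rewrite normrM mulrCA ler_wpM2l //.
  have := le_f x i; have := le_f x k; rewrite -!expr2.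
  rewrite -(real_normK (num_real (z x i 0))) -(real_normK (num_real (z x k 0))).
  (* Arithmetic-geometric mean: [|z_i| * |z_k|] is at most the mean of the two squares. *)
  have := sqr_ge0 (`|z x i 0| - `|z x k 0|); nra.
- by rewrite /f zt0 big1 // => i _; rewrite mxE mul0r.
Qed.

End LinearODE.

(** * The fundamental theorem of calculus for oriented integrals *)

Section OrientedIntegral.
Variable R : realType.
Implicit Types a s t : R.

Lemma continuous_integrable_segment (f : R -> R) a t :
  continuous f -> (@lebesgue_measure R).-integrable `[a, t] (EFin \o f).
Proof.
move=> cf; apply: continuous_compact_integrable; first exact: segment_compact.
exact: continuous_subspaceT.
Qed.

Lemma Rintegral_segmentB (f : R -> R) N a s : continuous f -> N <= a -> a <= s ->
  \int[@lebesgue_measure R]_(x in `[a, s]) f x =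
  \int[@lebesgue_measure R]_(x in `[N, s]) f x -
  \int[@lebesgue_measure R]_(x in `[N, a]) f x.
Proof.
move=> cf Na as_; rewrite Rintegral_itvB ?bnd_simp //; last first.
  exact: continuous_integrable_segment.
rewrite Rintegral_itv_obnd_cbnd //.
apply: (integrableS _ _ _ (continuous_integrable_segment a s cf)) => //.
by apply: subset_itvr; rewrite bnd_simp.
Qed.

(** A base point [N] below both endpoints treats the two orientations uniformly, as a difference of
    ordinary integrals. *)
Lemma oriented_integralE (f : R -> R) N a s : continuous f -> N <= a -> N <= s ->
  oriented_integral a s f =
  \int[@lebesgue_measure R]_(x in `[N, s]) f x -
  \int[@lebesgue_measure R]_(x in `[N, a]) f x.
Proof.
move=> cf Na Ns; rewrite /oriented_integral; case: leP => [as_|/ltW sa].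
  exact: Rintegral_segmentB.
by rewrite (Rintegral_segmentB cf Ns sa) opprB.
Qed.

Lemma is_derive_oriented_integral (f : R -> R) a t : continuous f ->
  is_derive t 1 (fun s => oriented_integral a s f) (f t).
Proof.
(* [N] lies strictly below [a] and [t], so [t] is interior to [[N, t + 1]] whichever side of [a] it
   is on. *)
move=> cf; pose N := Num.min a t - 1.
have Na : N < a by rewrite ltrBlDr gt_min ltrDl ltr01.
have Nt : N < t by rewrite ltrBlDr gt_min ltrDl ltr01 orbT.
pose P s := \int[@lebesgue_measure R]_(x in `[N, s]) f x.
have [dP P'] : derivable P t 1 /\ P^`()%classic t = f t.
  apply: (@continuous_FTC1_closed R f N t (t + 1)) => //.
  - by rewrite ltrDl ltr01.
  - exact: continuous_integrable_segment.
  - exact: cf.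
have hP : is_derive t 1 P (f t).
  by apply: DeriveDef; [exact: dP|rewrite -derive1E; exact: P'].
(* The difference formula needs [N <= s], which holds for [s] close to [t]. *)
apply: (@near_eq_is_derive _ _ _ (fun s => P s - P a)).
  near=> s; rewrite (@oriented_integralE f N) ?ltW //.
  near: s; exact: lt_nbhsr.
apply: (is_derive_eq (is_deriveB hP (is_derive_cst (P a) t 1))).
by rewrite subr0.
Unshelve. all: by end_near. Qed.

Lemma is_derive_mx_integral m n (f : R -> 'M[R]_(m, n)) a t :
  (forall i j, continuous (fun s => f s i j)) ->
  is_derive t 1 (fun s => mx_integral a s f) (f t).
Proof.
move=> cf; apply/is_derive_mxP => i j; under eq_fun do rewrite mxE.
exact: is_derive_oriented_integral.
Qed.

Lemma mx_integralaa m n (f : R -> 'M[R]_(m, n)) a :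
  (forall i j, continuous (fun s => f s i j)) -> mx_integral a a f = 0.
Proof.
move=> cf; apply/matrixP => i j.
by rewrite !mxE (@oriented_integralE _ a) // subrr.
Qed.


End OrientedIntegral.

(** * Even and odd parts *)

Section EvenOddDecomposition.
Variables (R : realType) (m n : nat).
Implicit Types (u : R -> 'M[R]_(m, n)) (t : R).

Lemma even_part_add_odd_part u t : even_part u t + odd_part u t = u t.
Proof. by apply/matrixP => i j; rewrite !mxE; field. Qed.

Lemma even_partN u t : even_part u (- t) = even_part u t.
Proof. by rewrite /even_part opprK addrC. Qed.

Lemma odd_partN u t : odd_part u (- t) = - odd_part u t.
Proof. by rewrite /odd_part opprK -scalerN opprB. Qed.

Lemma even_part0 u : even_part u 0 = u 0.
Proof. by apply/matrixP => i j; rewrite !mxE oppr0; field. Qed.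

Lemma odd_part0 u : odd_part u 0 = 0.
Proof. by rewrite /odd_part oppr0 subrr scaler0. Qed.

Definition even_odd u t : 'M[R]_(m + m, n) := col_mx (even_part u t) (odd_part u t).

Lemma row_mx11_even_odd u t : row_mx 1%:M 1%:M *m even_odd u t = u t.
Proof. by rewrite mul_row_col !mul1mx even_part_add_odd_part. Qed.

Lemma even_odd0 u : even_odd u 0 = col_mx (u 0) 0.
Proof. by rewrite /even_odd even_part0 odd_part0. Qed.

End EvenOddDecomposition.

(** * The reduced system without reflection *)

Section ReducedSystem.
Variables (R : realType) (n : nat).
Implicit Types (F G A B : 'M[R]_n) (t : R).

(** Differentiation swaps parity: the odd part of the equation gives
    [(F - G) u_e' = g_o - (A - B) u_o] and the even part [(F + G) u_o' = g_e - (A + B) u_e]. Hence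
    the zero diagonal blocks, and the odd part of [g] on top in [forcing]. *)
Definition generator F G A B : 'M[R]_(n + n) :=
  block_mx 0 (- (invmx (F - G) *m (A - B))) (- (invmx (F + G) *m (A + B))) 0.

Definition forcing F G m (g : R -> 'M[R]_(n, m)) t : 'M[R]_(n + n, m) :=
  col_mx (invmx (F - G) *m odd_part g t) (invmx (F + G) *m even_part g t).

(** Half the difference and half the sum of the equations at [t] and [- t]; both points must
    therefore lie in [D]. *)
Lemma solution_on_even_odd (D : set R) F G A B m (g u : R -> 'M[R]_(n, m)) t :
  F + G \in unitmx -> F - G \in unitmx ->
  solution_on D F G A B g u -> D t -> D (- t) ->
  is_derive t 1 (even_part u)
    (invmx (F - G) *m (odd_part g t - (A - B) *m odd_part u t)) /\
  is_derive t 1 (odd_part u)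
    (invmx (F + G) *m (even_part g t - (A + B) *m even_part u t)).
Proof.
move=> uP uM su Dt DNt.
have [/derivableP du] := su _ Dt; have [/derivableP du'] := su _ DNt.
rewrite opprK -!derive1E in du du' *.
move: (derive1 u t) (derive1 u (- t)) du du' => P Q du du' gNt gt.
have := is_derive_odd_part du du'; have := is_derive_even_part du du'.
rewrite /even_part /odd_part -gt -gNt => de do_; split.
  apply: (is_derive_eq de); apply: (canRL (mulKmx uM)).
  rewrite -!scalemxAr -scalerBr; congr (_ *: _).
  rewrite !mulmxBl !mulmxBr.
  (* With the matrix products generalized, only a linear identity between entries remains. *)
  move: (F *m P) (F *m Q) (G *m P) (G *m Q) (A *m u t) (A *m u (- t))
    (B *m u t) (B *m u (- t)) => FP FQ GP GQ a a' b b'.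
  by apply/matrixP => i j; rewrite !mxE; ring.
apply: (is_derive_eq do_); apply: (canRL (mulKmx uP)).
rewrite -!scalemxAr -scalerBr; congr (_ *: _).
rewrite !mulmxDl !mulmxDr.
move: (F *m P) (F *m Q) (G *m P) (G *m Q) (A *m u t) (A *m u (- t))
  (B *m u t) (B *m u (- t)) => FP FQ GP GQ a a' b b'.
by apply/matrixP => i j; rewrite !mxE; ring.
Qed.

Lemma is_derive_even_odd (D : set R) F G A B m (g u : R -> 'M[R]_(n, m)) t :
  F + G \in unitmx -> F - G \in unitmx ->
  solution_on D F G A B g u -> D t -> D (- t) ->
  is_derive t 1 (even_odd u) (generator F G A B *m even_odd u t + forcing F G g t).
Proof.
move=> uP uM su Dt DNt; have [de do_] := solution_on_even_odd uP uM su Dt DNt.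
apply: (is_derive_eq (is_derive_col_mx de do_)).
rewrite mul_block_col !mul0mx add0r addr0 add_col_mx !mulNmx -!mulmxA.
by rewrite mulmxBr addrC [in X in col_mx _ X]mulmxBr [X in col_mx _ X]addrC.
Qed.

Lemma forcing0 F G m t : forcing F G (fun=> 0 : 'M[R]_(n, m)) t = 0.
Proof.
rewrite /forcing /even_part /odd_part subrr addr0 scaler0 !mulmx0.
exact: col_mx0.
Qed.

(** Replacing [G, B] by [- G, - B] exchanges [F + G] with [F - G] and [A + B] with [A - B], so
    [(Y_o; Y_e)] satisfies the same reduced system as [(X_e; X_o)]. *)
Lemma is_derive_calX F G A B (X Y : R -> 'M[R]_n) t :
  F + G \in unitmx -> F - G \in unitmx ->
  solution_on setT F G A B (fun=> 0) X ->
  solution_on setT F (- G) A (- B) (fun=> 0) Y ->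
  is_derive t 1 (calX X Y) (generator F G A B *m calX X Y t).
Proof.
move=> uP uM sX sY.
have dX := is_derive_even_odd (t := t) uP uM sX I I.
have uM' : F - - G \in unitmx by rewrite opprK.
have [de do_] := solution_on_even_odd (t := t) uM uM' sY I I.
have calXE : calX X Y = fun s =>
    row_mx (even_odd X s) (col_mx (odd_part Y s) (even_part Y s)).
  by apply/funext => s; rewrite /calX block_mxEh.
rewrite calXE; apply: (is_derive_eq (is_derive_row_mx dX (is_derive_col_mx do_ de))).
rewrite forcing0 addr0 mul_mx_row; congr row_mx.
rewrite mul_block_col !mul0mx add0r addr0 !opprK /odd_part /even_part.
by rewrite !subrr !addr0 scaler0 !sub0r !mulmxN !mulNmx -!mulmxA.
Qed.

Lemma calX0 (X Y : R -> 'M[R]_n) : calX X Y 0 = block_mx (X 0) 0 0 (Y 0).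
Proof. by rewrite /calX !even_part0 !odd_part0. Qed.

(* A kernel vector [w] of [calX X Y t] makes [calX X Y s *m w] a solution of the
   reduced system vanishing at [t], hence everywhere, in particular at [0]. *)
Lemma calX_unitmx F G A B (X Y : R -> 'M[R]_n) t :
  F + G \in unitmx -> F - G \in unitmx ->
  solution_on setT F G A B (fun=> 0) X ->
  solution_on setT F (- G) A (- B) (fun=> 0) Y ->
  X 0 \in unitmx -> Y 0 \in unitmx ->
  calX X Y t \in unitmx.
Proof.
move=> uP uM sX sY uX uY.
(* Row freeness concerns left kernels; transposing gives a right kernel vector. *)
rewrite -unitmx_tr -row_free_unit; apply: inj_row_free => v vX.
have {vX} : calX X Y t *m v^T = 0.
  by apply: trmx_inj; rewrite trmx_mul trmxK vX trmx0.
suff w0 : calX X Y t *m v^T = 0 -> v^T = 0.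
  by move=> /w0 v0; rewrite -[v]trmxK v0 trmx0.
move: v^T => w Xw.
(* Radius of a bounded open interval containing both [t] and [0], as the uniqueness lemma
   requires. *)
pose b := `|t| + 1.
have tb : t \in `]- b, b[.
  by rewrite in_itv /= -ltr_norml /b ltrDl ltr01.
have b0 : 0 \in `]- b, b[.
  by rewrite in_itv /= -ltr_norml normr0 ltr_wpDl.
have : calX X Y 0 *m w = 0.
  apply: (@linear_ode_eq0 _ _ (generator F G A B) (fun s => calX X Y s *m w)
    (- b) b t) => // s _.
  by rewrite mulmxA; apply: is_derive_mulmxr; exact: is_derive_calX.
rewrite calX0 -[w]vsubmxK mul_block_col !mul0mx add0r addr0 -col_mx0.
move=> /eq_col_mx [Xw0 Yw0].
by rewrite -(mulKmx uX (usubmx w)) -(mulKmx uY (dsubmx w)) Xw0 Yw0 !mulmx0.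
Qed.

End ReducedSystem.

(** * Variation of constants and the return to the reflection problem *)

Section VariationOfParameters.
Variables (R : realType) (n : nat) (F G A B : 'M[R]_n).
Variables (gamma : R -> 'cV[R]_n) (X Y : R -> 'M[R]_n).
Hypotheses (uP : F + G \in unitmx) (uM : F - G \in unitmx).
Hypothesis gamma_cont : continuous gamma.
Hypothesis sX : solution_on setT F G A B (fun=> 0) X.
Hypothesis sY : solution_on setT F (- G) A (- B) (fun=> 0) Y.
Hypotheses (uX : X 0 \in unitmx) (uY : Y 0 \in unitmx).
Implicit Types (t : R) (c : 'cV[R]_n).

Let M := generator F G A B.
Let h := forcing F G gamma.
Let integrand s := invmx (calX X Y s) *m h s.

Definition vop_pair c t : 'cV[R]_(n + n) :=
  calX X Y t *m (col_mx c 0 + mx_integral 0 t integrand).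

Lemma continuous_forcing i j : continuous (fun s => h s i j).
Proof.
have cg k : continuous (fun s => gamma s k j).
  move=> t; apply: (@continuous_comp _ _ _ gamma (fun v : 'cV[R]_n => v k j)).
    exact: gamma_cont.
  exact: coord_continuous.
have cgN k : continuous (fun s => gamma (- s) k j).
  move=> t; apply: (@continuous_comp _ _ _ -%R (fun s => gamma s k j)).
    exact: opp_continuous.
  exact: cg.
rewrite /h /forcing; case: (splitP i) => k ik.
  have -> : i = lshift n k by exact: val_inj.
  under eq_fun do rewrite col_mxEu.
  apply: continuous_mulmx => [? ? ?|k' l]; first exact: cvg_cst.
  rewrite ord1 -(ord1 j); under eq_fun do rewrite !mxE.
  by move=> t; apply: cvgMr; apply: cvgB; [exact: cg|exact: cgN].
have -> : i = rshift n k by exact: val_inj.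
under eq_fun do rewrite col_mxEd.
apply: continuous_mulmx => [? ? ?|k' l]; first exact: cvg_cst.
rewrite ord1 -(ord1 j); under eq_fun do rewrite !mxE.
by move=> t; apply: cvgMr; apply: cvgD; [exact: cg|exact: cgN].
Qed.

(** Invertibility of [calX] on the whole line gives continuity everywhere, so the integral can be
    differentiated at every point. *)
Lemma continuous_integrand i j : continuous (fun s => integrand s i j).
Proof.
apply: continuous_mulmx => [k l|]; last exact: continuous_forcing.
apply: continuous_invmx => [k' l' t|s]; last exact: (calX_unitmx s uP uM sX sY).
exact: (is_derive_mx_continuous (is_derive_calX t uP uM sX sY)).
Qed.

Lemma is_derive_vop_pair c t :
  is_derive t 1 (vop_pair c) (M *m vop_pair c t + h t).
Proof.
have dI := is_derive_mx_integral 0 t continuous_integrand.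
have dcI := is_deriveD (is_derive_cst (col_mx c 0) t 1) dI.
apply: (is_derive_eq (is_derive_mulmx (is_derive_calX t uP uM sX sY) dcI)).
by rewrite add0r mulKVmx ?mulmxA //; exact: (calX_unitmx t uP uM sX sY).
Qed.

Lemma vop_pair0 c : vop_pair c 0 = col_mx (X 0 *m c) 0.
Proof.
rewrite /vop_pair mx_integralaa; last exact: continuous_integrand.
by rewrite addr0 calX0 mul_block_col !mulmx0 mul0mx !addr0.
Qed.

(** Adding the two block rows of [calX X Y t] gives [(X t | Y t)]. *)
Lemma variation_of_parametersE c t :
  variation_of_parameters F G gamma X Y c t = row_mx 1%:M 1%:M *m vop_pair c t.
Proof.
rewrite mulmxA mul_row_block !mul1mx even_part_add_odd_part.
rewrite [odd_part Y t + _]addrC even_part_add_odd_part mulmxDr.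
by rewrite mul_row_col mulmx0 addr0.
Qed.

(* The reflection [diag(1, -1) z(-t)] of [z := vop_pair c] solves the same initial
   value problem as [z]. *)
Lemma vop_pairN c t :
  vop_pair c (- t) = col_mx (usubmx (vop_pair c t)) (- dsubmx (vop_pair c t)).
Proof.
pose S : 'M[R]_(n + n) := block_mx 1%:M 0 0 (- 1%:M).
have SE (z : 'cV[R]_(n + n)) : S *m z = col_mx (usubmx z) (- dsubmx z).
  by rewrite -{1}[z]vsubmxK mul_block_col !mul0mx add0r addr0 mulNmx !mul1mx.
have SM : S *m M = - (M *m S).
  rewrite !mulmx_block !mul0mx !mulmx0 !mulNmx !mul1mx !mulmxN !mulmx1.
  by rewrite !(addr0, add0r, oppr0) opp_block_mx !oppr0 !opprK.
have Sh s : S *m h (- s) = - h s.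
  rewrite mul_block_col !mul0mx add0r addr0 mulNmx !mul1mx.
  by rewrite even_partN odd_partN mulmxN opp_col_mx.
pose b := `|t| + 1.
have tb : - t \in `]- b, b[.
  by rewrite in_itv /= -ltr_norml normrN /b ltrDl ltr01.
have b0 : 0 \in `]- b, b[.
  by rewrite in_itv /= -ltr_norml normr0 ltr_wpDl.
have : vop_pair c (- t) - S *m vop_pair c (- - t) = 0.
  apply: (@linear_ode_eq0 _ _ M (fun s => vop_pair c s - S *m vop_pair c (- s))
    (- b) b 0) => // [s _|].
    (* The minus sign of the chain rule cancels those in [SM] and [Sh]. *)
    have dS := is_derive_mulmxl S (is_derive_mx_comp_opp (is_derive_vop_pair c (- s))).
    apply: (is_derive_eq (is_deriveB (is_derive_vop_pair c s) dS)).
    rewrite mulmxN opprK mulmxDr Sh [S *m (M *m _)]mulmxA SM mulNmx -mulmxA.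
    by rewrite addrACA subrr addr0 mulmxBr.
  by rewrite oppr0 vop_pair0 SE col_mxKu col_mxKd oppr0 subrr.
by rewrite opprK SE => /eqP; rewrite subr_eq0 => /eqP.
Qed.

(** By [vop_pairN] the blocks of [vop_pair c] are the even and odd parts of the candidate, which
    gives its value and derivative at [- t] from data at [t]. *)
Lemma variation_of_parameters_solution c :
  solution_on setT F G A B gamma (variation_of_parameters F G gamma X Y c).
Proof.
move=> t _.
have dv (s : R) : is_derive s 1 (variation_of_parameters F G gamma X Y c)
    (row_mx 1%:M 1%:M *m (M *m vop_pair c s + h s)).
  have -> : variation_of_parameters F G gamma X Y c =
      fun s => row_mx 1%:M 1%:M *m vop_pair c s.
    by apply/funext => r; exact: variation_of_parametersE.
  exact: (is_derive_mulmxl _ (is_derive_vop_pair c s)).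
split; first by case: (dv t).
have dvE s := @derive_val _ _ _ _ _ _ _ (dv s).
rewrite !derive1E !dvE !variation_of_parametersE vop_pairN.
move: (vop_pair c t) => z; rewrite -[z]vsubmxK col_mxKu col_mxKd.
move: (usubmx z) (dsubmx z) => z1 z2.
rewrite /M /h /generator /forcing !mul_block_col !mul0mx !add0r !addr0.
rewrite !add_col_mx !mul_row_col !mul1mx even_partN odd_partN.
rewrite !(mulmxN, mulNmx) -!mulmxA opprK.
(* [p] and [q] are the derivatives of the two blocks at [t]: the candidate has derivative [p + q] at
   [t] and [q - p] at [- t]. *)
set p := invmx (F - G) *m (odd_part gamma t - (A - B) *m z2).
set q := invmx (F + G) *m (even_part gamma t - (A + B) *m z1).
have -> : - (invmx (F - G) *m ((A - B) *m z2)) +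
    invmx (F - G) *m odd_part gamma t = p.
  by rewrite /p mulmxBr addrC.
have -> : - (invmx (F + G) *m ((A + B) *m z1)) +
    invmx (F + G) *m even_part gamma t = q.
  by rewrite /q mulmxBr addrC.
have -> : invmx (F - G) *m ((A - B) *m z2) -
    invmx (F - G) *m odd_part gamma t = - p.
  by rewrite /p mulmxBr opprB.
have hp : F *m p = G *m p + odd_part gamma t - (A - B) *m z2.
  have : (F - G) *m p = odd_part gamma t - (A - B) *m z2 by rewrite mulKVmx.
  by move/eqP; rewrite mulmxBl subr_eq addrC addrA => /eqP.
have hq : F *m q = - (G *m q) + even_part gamma t - (A + B) *m z1.
  have : (F + G) *m q = even_part gamma t - (A + B) *m z1 by rewrite mulKVmx.
  by move/eqP; rewrite mulmxDl eq_sym -subr_eq eq_sym addrC addrA => /eqP.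
rewrite -[RHS]even_part_add_odd_part !mulmxDr !mulmxN hp hq !mulmxBl !mulmxDl.
move: (even_part gamma t) (odd_part gamma t) (G *m p) (G *m q) (A *m z1)
  (A *m z2) (B *m z1) (B *m z2) => g1 g2 Gp Gq a1 a2 b1 b2.
by apply/matrixP => i j; rewrite !mxE; ring.
Qed.

Lemma is_derive_even_odd_solution (e : R) (u : R -> 'cV[R]_n) t :
  solution_on `]- e, e[ F G A B gamma u -> t \in `]- e, e[ ->
  is_derive t 1 (even_odd u) (M *m even_odd u t + h t).
Proof.
move=> su te; have Nte : - t \in `]- e, e[ by rewrite oppr_itvoo opprK.
exact: is_derive_even_odd uP uM su te Nte.
Qed.

(** One direction is uniqueness for the reduced system; the other holds because derivatives are
    local and the interval is open and symmetric. *)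
Lemma solution_onP (e : R) (u : R -> 'cV[R]_n) : 0 < e ->
  solution_on `]- e, e[ F G A B gamma u <->
  exists c, forall t, t \in `]- e, e[ ->
    u t = variation_of_parameters F G gamma X Y c t.
Proof.
move=> e0; split=> [su|[c uE] t te].
  (* This [c] makes [vop_pair c 0] equal to [(u 0; 0)], the value of [even_odd u] at [0]. *)
  exists (invmx (X 0) *m u 0) => t te.
  rewrite variation_of_parametersE -[u t]row_mx11_even_odd; congr (_ *m _).
  apply/eqP; rewrite -subr_eq0; apply/eqP.
  apply: (@linear_ode_eq0 _ _ M
    (fun s => even_odd u s - vop_pair (invmx (X 0) *m u 0) s) (- e) e 0) => //.
  - move=> s se; have du := is_derive_even_odd_solution su se.
    apply: (is_derive_eq (is_deriveB du (is_derive_vop_pair _ s))).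
    by rewrite mulmxBr opprD addrACA subrr addr0.
  - by rewrite in_itv /= oppr_lt0 e0.
  - by rewrite even_odd0 vop_pair0 mulKVmx // subrr.
have Nte : - t \in `]- e, e[ by rewrite oppr_itvoo opprK.
have du (s : R) : s \in `]- e, e[ -> derivable u s 1 /\
    derive1 u s = derive1 (variation_of_parameters F G gamma X Y c) s.
  move=> se; have nse : \near s, variation_of_parameters F G gamma X Y c s = u s.
    near=> r; rewrite uE //; near: r; exact: near_in_itvoo.
  split.
    apply: (near_eq_derivable nse).
    by have [] := variation_of_parameters_solution c (t := s) I.
  by rewrite !derive1E; apply/esym/near_eq_derive.
have [dut ->] := du t te; have [_ ->] := du _ Nte; split => //.
rewrite !uE //.
by have [] := variation_of_parameters_solution c (t := t) I.
Unshelve. all: by end_near. Qed.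

(** The formula is itself a solution on the whole line, so it serves as the extension of [v]. *)
Lemma restriction_solution_onP (d : R) (v : R -> 'cV[R]_n) : 0 < d ->
  (exists2 u : R -> 'cV[R]_n, solution_on setT F G A B gamma u &
     forall t, t \in `]- d, d[ -> v t = u t) <->
  exists c, forall t, t \in `]- d, d[ ->
    v t = variation_of_parameters F G gamma X Y c t.
Proof.
move=> d0; split=> [[u su vu]|[c vE]].
  have /(solution_onP u d0) [c uE] : solution_on `]- d, d[ F G A B gamma u.
    by move=> t _; exact: su.
  by exists c => t td; rewrite vu // uE.
exists (variation_of_parameters F G gamma X Y c) => //.
exact: variation_of_parameters_solution.
Qed.

End VariationOfParameters.

Theorem theorem5p6 (R : realType) (n : nat) (F G A B : 'M[R]_n)
    (gamma : R -> 'cV[R]_n) (X Y : R -> 'M[R]_n) :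
  F + G \in unitmx -> F - G \in unitmx -> continuous gamma ->
  fundamental_matrix F G A B X ->
  fundamental_matrix F (- G) A (- B) Y ->
  exists2 d : R, 0 < d &
  [/\ (forall t, t \in `]- d, d[ -> calX X Y t \in unitmx),
      (* solutions defined on a symmetric neighborhood of zero *)
      (forall e, 0 < e -> e <= d -> forall u : R -> 'cV[R]_n,
         solution_on `]- e, e[ F G A B gamma u <->
         exists c : 'cV[R]_n, forall t, t \in `]- e, e[ ->
           u t = variation_of_parameters F G gamma X Y c t)
      (* restrictions to ]-d, d[ of solutions defined on the whole line *)
    & (forall v : R -> 'cV[R]_n,
         (exists2 u : R -> 'cV[R]_n, solution_on setT F G A B gamma u &
            forall t, t \in `]- d, d[ -> v t = u t) <->
         exists c : 'cV[R]_n, forall t, t \in `]- d, d[ ->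
           v t = variation_of_parameters F G gamma X Y c t)].
Proof.
move=> uP uM cgamma [_ sX uX _] [_ sY uY _].
(* Any positive radius would do, since [calX] is invertible on the whole line. *)
exists 1; first exact: ltr01.
split=> [t _|e e0 _ u|v].
- exact: (calX_unitmx t uP uM sX sY).
- exact: solution_onP.
- by apply: restriction_solution_onP; rewrite ?ltr01.
Qed.
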